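(* Let $(F_n(X,Y))_{n\ge 0}$ be a sequence of nonzero polynomials with non-negative integer coefficients such that $F_n(0,0)=0$ for every $n\ge 0$. Define $(x_n)_{n\ge 0}$ by $x_0=1$, $x_1\in\mathbb{Z}_{>0}$ and $$x_{n+2}x_n=x_{n+1}^2\bigl(F_n(x_n,x_{n+1})+1\bigr)\qquad(n\ge 0).$$ Then $(x_n)$ is a sequence of positive integers such that $x_n\mid x_{n+1}$ and $x_n\mid F_n(x_n,x_{n+1})$ for every $n\ge 0$. Moreover, for any positive integer $h$, the series $S=\sum_{n=0}^{\infty}\frac{h^n}{x_{n+1}}$ has the infinite continued fraction expansion $$S=\cfrac{a_1}{b_1+\cfrac{a_2}{b_2+\cfrac{a_3}{b_3+\cdots}}},$$ where $a_1=1$, $b_1=x_1-h$, and for $k\ge 1$ $$a_{2k}=h,\quad a_{2k+1}=1,\quad b_{2k}=x_{k-1},\quad b_{2k+1}=\frac{\theta^2x_{k-1}-1}{x_{k-1}}=\frac{F_{k-1}(x_{k-1},x_k)}{x_{k-1}}$$ are rational integers.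
   Context: Notation: $\theta^2x_k=\dfrac{x_{k+2}x_k}{x_{k+1}^2}$ for $k\ge 0$. The value of an infinite continued fraction with partial numerators $a_m$ and partial denominators $b_m$ is $\lim_{m\to\infty}P_m/Q_m$, where $P_0=0$, $Q_0=1$, $P_1=a_1$, $Q_1=b_1$, and $P_{k+2}=b_{k+2}P_{k+1}+a_{k+2}P_k$, $Q_{k+2}=b_{k+2}Q_{k+1}+a_{k+2}Q_k$ for $k\ge 0$ (the limit being taken over $m$ large enough that $Q_m\ne 0$). *)

(* Defs.v *)
From HB Require Import structures.
From mathcomp Require Export all_boot all_order all_algebra.
From mathcomp Require Export all_classical all_reals all_analysis.
Export Order.TTheory GRing.Theory Num.Theory numFieldNormedType.Exports.

Set Implicit Arguments.
Unset Strict Implicit.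
Unset Printing Implicit Defensive.

Local Open Scope ring_scope.
Local Open Scope classical_set_scope.

(* Z[X, Y] is {poly {poly int}} with the conventions of polyXY: the outer     *)
(* variable is X, the inner one is Y, F`_i`_j is the coefficient of X^i Y^j   *)
(* and F.[x, y] is the value of F at X = x, Y = y.                            *)

Definition evalXY (R : realType) (F : {poly {poly int}}) (x y : R) : R :=
  (map_poly (map_poly intr) F).[x, y].

Definition theta2 (R : realType) (x : nat -> R) (k : nat) : R :=
  x k.+2 * x k / x k.+1 ^+ 2.

(* Partial numerators a m and denominators b m are indexed by m >= 1;         *)
(* a 0 and b 0 are not used.                                                  *)
Fixpoint cf_num (R : realType) (a b : nat -> R) (m : nat) : R :=
  match m with
  | 0%N => 0
  | 1%N => a 1%N
  | (k.+1 as k1).+1 => b k.+2 * cf_num a b k1 + a k.+2 * cf_num a b k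
  end.

Fixpoint cf_den (R : realType) (a b : nat -> R) (m : nat) : R :=
  match m with
  | 0%N => 1
  | 1%N => b 1%N
  | (k.+1 as k1).+1 => b k.+2 * cf_den a b k1 + a k.+2 * cf_den a b k
  end.

(* Finitely many denominators are allowed to vanish.                          *)
Definition cf_value (R : realType) (a b : nat -> R) (S : R) : Prop :=
  (\forall m \near \oo, cf_den a b m != 0) /\
  (fun m => cf_num a b m / cf_den a b m) @ \oo --> S.

(* Main.v *)
(** The denominators of the continued fraction are Q_(2k) = x_k and
    Q_(2k+1) = x_(k+1)/x_k - h.  If S_k is the k-th partial sum of the series,
    then the numerators are P_(2k) = S_k Q_(2k) and
    P_(2k+1) = S_k Q_(2k+1) + h^k/x_k, so the even convergents are exactly the
    partial sums and the odd ones differ from them by h^k/(x_k Q_(2k+1)).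
    Since x_n divides x_(n+1) and F_n(0,0) = 0, x_n divides the positive integer
    F_n(x_n, x_(n+1)); hence the ratios x_(n+1)/x_n at least double at each
    step, the series converges and Q_(2k+1) tends to infinity. *)

Require Import Defs.
From mathcomp Require Import ring lra.

Set Implicit Arguments.
Unset Strict Implicit.
Unset Printing Implicit Defensive.

Local Open Scope ring_scope.
Local Open Scope classical_set_scope.

(** * Positivity and divisibility of values of polynomials *)

Lemma horner_gt0 (K : numDomainType) (p : {poly K}) (t : K) :
  (forall i, 0 <= p`_i) -> p != 0 -> 0 < t -> 0 < p.[t].
Proof.
move=> p_ge0 p_neq0 t_gt0; rewrite horner_coef.
have [n size_p] : exists n, size p = n.+1.
  by exists (size p).-1; rewrite prednK // lt0n size_poly_eq0.
rewrite size_p big_ord_recr /= ltr_wpDl //.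
  by apply: sumr_ge0 => i _; rewrite mulr_ge0 // exprn_ge0 // ltW.
rewrite mulr_gt0 ?exprn_gt0 // lt_def p_ge0 andbT.
by move: p_neq0; rewrite -lead_coef_eq0 lead_coefE size_p.
Qed.

Lemma horner_ge0 (K : numDomainType) (p : {poly K}) (t : K) :
  (forall i, 0 <= p`_i) -> 0 < t -> 0 <= p.[t].
Proof.
move=> p_ge0 t_gt0; have [->|p_neq0] := eqVneq p 0; first by rewrite horner0.
by rewrite ltW ?horner_gt0.
Qed.

(** Evaluating the inner variable first leaves a univariate polynomial over [K] with non-negative
    coefficients. It is nonzero because the leading coefficient of [P], itself a nonzero polynomial,
    is positive at [t]. *)
Lemma horner2_gt0 (K : numDomainType) (P : {poly {poly K}}) (s t : K) :
  (forall i j, 0 <= P`_i`_j) -> P != 0 -> 0 < s -> 0 < t -> 0 < P.[s, t].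
Proof.
move=> P_ge0 P_neq0 s_gt0 t_gt0.
have -> : P.[s, t] = (map_poly (horner_eval t) P).[s].
  by rewrite -[in RHS](hornerC s t) (horner_map (horner_eval t)).
have coef_t i : (map_poly (horner_eval t) P)`_i = (P`_i).[t].
  by rewrite coef_map.
apply: horner_gt0 => // [i|]; first by rewrite coef_t horner_ge0.
apply/eqP => /polyP/(_ (size P).-1); rewrite coef_t coef0 => /eqP.
apply/negP; rewrite gt_eqF // horner_gt0 //.
by rewrite -lead_coefE lead_coef_eq0.
Qed.

Lemma horner_eq_horner0 (K : comNzRingType) (p : {poly K}) (t : K) :
  exists c, p.[t] = c * t + p.[0].
Proof.
elim/poly_ind: p => [|p c _]; first by exists 0; rewrite !horner0 mul0r addr0.
by exists p.[t]; rewrite !hornerMXaddC mulr0 add0r.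
Qed.

(** Splitting off the constant term in each variable in turn gives P(s,t) = c(t) s + e t +
    P(0,0). *)
Lemma dvdz_horner2 (P : {poly {poly int}}) (d s t : int) :
  P.[0, 0] = 0 -> (d %| s)%Z -> (d %| t)%Z -> (d %| P.[s, t])%Z.
Proof.
move=> P00 ds dt; have [c ->] := horner_eq_horner0 P s%:P.
have [e Pt] := horner_eq_horner0 P.[0] t.
move: P00; rewrite polyC0 !hornerE => P00.
by rewrite Pt P00 addr0 rpredD // dvdz_mull.
Qed.

Lemma evalXY_int (R : realType) (P : {poly {poly int}}) (s t : int) :
  evalXY P (s%:~R : R) t%:~R = (P.[s, t])%:~R.
Proof.
rewrite /evalXY.
have -> : (s%:~R : R)%:P = map_poly intr s%:P by rewrite map_polyC.
by rewrite horner_map horner_map.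
Qed.

(** * Integrality of the sequence *)

Lemma recurrence_int (R : realType) (F : nat -> {poly {poly int}})
    (x : nat -> R) (x1 : nat) :
  (forall n, F n != 0) -> (forall n i j, 0 <= (F n)`_i`_j) ->
  (forall n, (F n).[0, 0] = 0) ->
  x 0%N = 1 -> (0 < x1)%N -> x 1%N = x1%:R ->
  (forall n,
     x n.+2 * x n = x n.+1 ^+ 2 * (evalXY (F n) (x n) (x n.+1) + 1)) ->
  exists z : nat -> int,
    [/\ forall n, x n = (z n)%:~R, forall n, 0 < z n,
        forall n, (z n %| z n.+1)%Z & forall n, (z n %| (F n).[z n, z n.+1])%Z].
Proof.
move=> F_neq0 F_ge0 F_00 x_0 x1_gt0 x_1 x_rec.
(* The induction carries the integer ratio q = x_(n+1)/x_n: the recurrence multiplies it by F_n(x_n,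
   x_(n+1)) + 1, a positive integer. *)
have step n : exists p q : int,
    [/\ x n = p%:~R, x n.+1 = (q * p)%:~R, 0 < p & 0 < q].
  elim: n => [|n [p [q [xp xq p_gt0 q_gt0]]]].
    by exists 1, x1%:Z; split; rewrite ?mulr1.
  exists (q * p), (q * ((F n).[p, q * p] + 1)); split => //.
  - have := x_rec n; rewrite xp xq evalXY_int => e.
    have p_neq0 : p%:~R != 0 :> R by rewrite intr_eq0 gt_eqF.
    by apply: (mulIf p_neq0); rewrite e; ring.
  - by rewrite mulr_gt0.
  - by rewrite mulr_gt0 // ltr_wpDl // ltW // horner2_gt0 // mulr_gt0.
have zE n : x n = (Num.floor (x n))%:~R.
  by have [p [q [-> _ _ _]]] := step n; rewrite intrKfloor.
have z_dvd n : (Num.floor (x n) %| Num.floor (x n.+1))%Z.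
  by have [p [q [-> -> _ _]]] := step n; rewrite !intrKfloor dvdz_mull.
exists (fun n => Num.floor (x n)); split => // n.
- by have [p [q [-> _ ? _]]] := step n; rewrite intrKfloor.
- by rewrite dvdz_horner2.
Qed.

(** * Closed forms of the convergents *)

Lemma cf_num_den_rec (R : realType) (x a b : nat -> R) (h : R) :
  (forall n, x n != 0) -> x 0%N = 1 -> b 1%N = x 1%N - h ->
  (forall k, a k.*2.+1 = 1) -> (forall k, a k.+1.*2 = h) ->
  (forall k, b k.+1.*2 = x k) ->
  (forall k, b k.+1.*2.+1 = (theta2 x k - 1) / x k) ->
  forall k,
    [/\ cf_den a b k.*2 = x k,
        cf_den a b k.*2.+1 = x k.+1 / x k - h,
        cf_num a b k.*2 = series (fun n => h ^+ n / x n.+1) k * x k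
      & cf_num a b k.*2.+1 =
          series (fun n => h ^+ n / x n.+1) k * (x k.+1 / x k - h)
          + h ^+ k / x k].
Proof.
move=> x_neq0 x_0 b_1 a_odd a_even b_even b_odd.
set S := series _.
have S_rec k : S k.+1 = S k + h ^+ k / x k.+1 by rewrite /S seriesSr.
have S_0 : S 0%N = 0 by rewrite /S /series /= big_nil.
have denSS m :
    cf_den a b m.+2 = b m.+2 * cf_den a b m.+1 + a m.+2 * cf_den a b m by [].
have numSS m :
    cf_num a b m.+2 = b m.+2 * cf_num a b m.+1 + a m.+2 * cf_num a b m by [].
elim=> [|k [den0 den1 num0 num1]].
  rewrite S_0 x_0 expr0 !mul0r add0r !divr1.
  by split=> //=; exact: (a_odd 0%N).
have den2 : cf_den a b k.+1.*2 = x k.+1.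
  rewrite doubleS denSS den0 den1 -doubleS a_even b_even.
  by field; rewrite x_neq0.
have num2 : cf_num a b k.+1.*2 = S k.+1 * x k.+1.
  rewrite doubleS numSS num0 num1 -doubleS a_even b_even S_rec.
  by field; rewrite !x_neq0.
split=> //.
(* The -1 in b_(2k+3) cancels the x_(k+1)/x_k coming from Q_(2k+1), which leaves [theta2 x k] *
   x_(k+1)/x_k - h = x_(k+2)/x_(k+1) - h. *)
- rewrite denSS den2 -doubleS den1 b_odd a_odd /theta2.
  by field; rewrite !x_neq0.
- rewrite numSS num2 -doubleS num1 b_odd a_odd /theta2 S_rec (exprS h).
  by field; rewrite !x_neq0.
Qed.

(** * Growth of the sequence *)

Lemma ratio_geometric_lower_bound (R : realFieldType) (x : nat -> R) (c : R)
    (N : nat) :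
  1 <= c -> (forall n, 1 <= x n) ->
  (forall n, (N <= n)%N -> c * x n <= x n.+1) ->
  forall n, c ^+ n / c ^+ N <= x n.
Proof.
move=> c_ge1 x_ge1 x_ratio.
have c_gt0 : 0 < c by exact: lt_le_trans c_ge1.
(* The factor c^(-N) keeps the bound at most 1 up to index N, so the estimate holds at every index
   and not only eventually. *)
have small n : (n <= N)%N -> c ^+ n / c ^+ N <= x n.
  move=> nN; apply: le_trans (x_ge1 n).
  by rewrite ler_pdivrMr ?exprn_gt0 // mul1r ler_weXn2l.
elim=> [|n IHn]; first exact: small.
have [/small //|Nn] := leqP n.+1 N.
apply: le_trans (x_ratio n Nn).
by rewrite exprS -mulrA ler_pM2l.
Qed.

(** The ratio x_(n+1)/x_n starts at 1 or more and is multiplied by [G n + 1], hence by at least 2,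
    at each step. *)
Lemma ratio_ge_expr2 (R : realFieldType) (x G : nat -> R) :
  (forall n, 0 < x n) -> (forall n, 1 <= G n) -> x 0%N <= x 1%N ->
  (forall n, x n.+2 * x n = x n.+1 ^+ 2 * (G n + 1)) ->
  forall n, 2 ^+ n * x n <= x n.+1.
Proof.
move=> x_gt0 G_ge1 x01 x_rec; elim=> [|n IHn]; first by rewrite mul1r.
rewrite -(ler_pM2r (x_gt0 n)) x_rec.
rewrite exprS; have := G_ge1 n; have := x_gt0 n.+1; move: (2 ^+ n) IHn => r.
by move=> IHn x_pos g_ge1; nra.
Qed.

(** Each u_m is compared with the even-indexed term at 2 floor(m/2): the difference is 0 for even m
    and a gap between consecutive terms for odd m, and these gaps tend to 0. *)
Lemma cvgn_even_odd (R : realType) (u : nat -> R) (l : R) :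
  u k.*2 @[k --> \oo] --> l -> u k.*2.+1 @[k --> \oo] --> l ->
  u @ \oo --> l.
Proof.
move=> u_even u_odd.
have half_oo : (fun m => m %/ 2)%N @ \oo --> \oo by exact: cvg_divnr.
have even_half := cvg_comp _ _ half_oo u_even.
have gap : u k.*2.+1 - u k.*2 @[k --> \oo] --> 0.
  by rewrite -(subrr l); exact: cvgB.
have gap_half := cvg_comp _ _ half_oo gap.
have d0 : (fun m => u m - u (m %/ 2).*2) @ \oo --> 0.
  apply/norm_cvg0P; apply: (squeeze_cvgr _ (cvg_cst 0)); last first.
    by rewrite -(normr0 R); apply: cvg_norm gap_half.
  apply: nearW => m /=; rewrite normr_ge0 divn2.
  rewrite -{1}(odd_double_half m).
  case: (odd m); rewrite ?add1n ?add0n ?lexx //=.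
  by rewrite subrr normr0.
rewrite -[l]add0r; apply: cvg_trans (cvgD d0 even_half).
by apply: near_eq_cvg; apply: nearW => m /=; rewrite subrK.
Qed.

Theorem mainTheorem4 (R : realType) (F : nat -> {poly {poly int}})
    (F_neq0 : forall n, F n != 0)
    (F_coef_ge0 : forall n i j, 0 <= (F n)`_i`_j)
    (F_00 : forall n, (F n).[0, 0] = 0)
    (x : nat -> R) (x1 : nat)
    (x_0 : x 0%N = 1)
    (x1_gt0 : (0 < x1)%N)
    (x_1 : x 1%N = x1%:R)
    (x_rec : forall n,
       x n.+2 * x n = x n.+1 ^+ 2 * (evalXY (F n) (x n) (x n.+1) + 1)) :
  (exists z : nat -> int,
     [/\ forall n, x n = (z n)%:~R,
         forall n, 0 < z n,
         forall n, (z n %| z n.+1)%Z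
       & forall n, (z n %| (F n).[z n, z n.+1])%Z])
  /\
  (forall (h : nat) (a b : nat -> R),
     (0 < h)%N ->
     a 1%N = 1 ->
     b 1%N = x 1%N - h%:R ->
     (forall k, (1 <= k)%N ->
        [/\ a (2 * k)%N = h%:R,
            a (2 * k + 1)%N = 1,
            b (2 * k)%N = x (k - 1)%N
          & b (2 * k + 1)%N = (theta2 x (k - 1) - 1) / x (k - 1)%N]) ->
     [/\ forall k, (1 <= k)%N ->
           b (2 * k + 1)%N =
             evalXY (F (k - 1)%N) (x (k - 1)%N) (x k) / x (k - 1)%N,
         forall m, (1 <= m)%N ->
           a m \is a Num.int /\ b m \is a Num.int,
         cvgn (series (fun n => h%:R ^+ n / x n.+1))
       & cf_value a b (limn (series (fun n => h%:R ^+ n / x n.+1)))]).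
Proof.
have := recurrence_int F_neq0 F_coef_ge0 F_00 x_0 x1_gt0 x_1 x_rec.
case=> z [xz z_gt0 z_dvd z_dvdF].
split; first by exists z.
move=> h a b h_gt0 a_1 b_1 ab.
have x_gt0 n : 0 < x n by rewrite xz ltr0z.
have x_neq0 n : x n != 0 by rewrite gt_eqF.
have x_ge1 n : 1 <= x n by rewrite xz ler1z -gtz0_ge1.
have evalE n : evalXY (F n) (x n) (x n.+1) = ((F n).[z n, z n.+1])%:~R.
  by rewrite !xz evalXY_int.
have eval_ge1 n : 1 <= evalXY (F n) (x n) (x n.+1).
  by rewrite evalE ler1z -gtz0_ge1 horner2_gt0.
have theta2E n : theta2 x n - 1 = evalXY (F n) (x n) (x n.+1).
  by rewrite /theta2 x_rec mulrC mulKf ?addrK // expf_neq0.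
have a_odd k : a k.*2.+1 = 1.
  case: k => [//|k]; have [//|_ + _ _] := ab k.+1.
  by rewrite addn1 mul2n.
have a_even k : a k.+1.*2 = h%:R.
  by have [//|+ _ _ _] := ab k.+1; rewrite mul2n.
have b_even k : b k.+1.*2 = x k.
  by have [//|_ _ + _] := ab k.+1; rewrite mul2n subn1.
have b_odd k : b k.+1.*2.+1 = (theta2 x k - 1) / x k.
  by have [//|_ _ _ +] := ab k.+1; rewrite addn1 mul2n subn1.
have cf := cf_num_den_rec x_neq0 x_0 b_1 a_odd a_even b_even b_odd.
set S := series _ in cf *.
have ratio n : 2 ^+ n * x n <= x n.+1.
  by move: n; apply: (ratio_ge_expr2 x_gt0 eval_ge1) => //; rewrite x_0.
have h_pos : 0 < h%:R :> R by rewrite ltr0n.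
have h_ge1 : 1 <= h%:R :> R by rewrite ler1n.
(* The threshold comes from 2h <= n < 2^n. The factor 2h beats h^n by 2^n in the series and leaves a
   margin h after subtracting h in Q_(2k+1). *)
have ratio_h n : (h.*2 <= n)%N -> 2 * h%:R * x n <= x n.+1.
  move=> hn; apply: le_trans (ratio n); rewrite ler_pM2r //.
  rewrite -natrM mul2n -natrX ler_nat.
  by apply: leq_trans hn _; rewrite ltnW // ltn_expl.
have S_cvg : cvgn S.
  pose c : R := 2 * h%:R.
  have c_gt0 : 0 < c by rewrite mulr_gt0.
  have x_geom := ratio_geometric_lower_bound (c := c) _ x_ge1 ratio_h.
  (* With c = 2h, the bound x_(n+1) >= c^(n+1)/c^(2h) and h^n = c^n 2^(-n) give this majorant of
     h^n/x_(n+1). *)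
  pose v := geometric (c ^+ h.*2 / c) (2^-1 : R).
  apply: (@series_le_cvg _ _ v) => [n|n|n|].
  - by rewrite divr_ge0 ?exprn_ge0 // ltW.
  - by rewrite /v /= mulr_ge0 ?divr_ge0 ?exprn_ge0 // ltW.
  - rewrite ler_pdivrMr // /v /=.
    have -> : h%:R ^+ n
        = c ^+ h.*2 / c * 2^-1 ^+ n * (c ^+ n.+1 / c ^+ h.*2).
      have -> : h%:R ^+ n = c ^+ n * 2^-1 ^+ n.
        by rewrite -exprMn /c mulrAC mulfV ?mul1r // pnatr_eq0.
      rewrite [c ^+ n.+1]exprS; move: (2^-1 ^+ n) => t.
      have c_neq0 : c != 0 by rewrite gt_eqF.
      by field; rewrite expf_neq0 ?c_neq0.
    rewrite ler_pM2l ?x_geom //; first by rewrite /c; nra.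
    by rewrite mulr_gt0 ?divr_gt0 ?exprn_gt0 ?invr_gt0.
  - apply: is_cvg_geometric_series.
    by rewrite ger0_norm ?invr_ge0 // invf_lt1 // ltr1n.
(* Here Q_(2k+1) >= 2h - h >= 1. Earlier odd denominators may vanish, for instance Q_1 when x_1 =
   h. *)
have den_ge1 k : (h.*2 <= k)%N -> 1 <= cf_den a b k.*2.+1.
  move=> hk; have [_ -> _ _] := cf k.
  have : 2 * h%:R <= x k.+1 / x k by rewrite ler_pdivlMr // ratio_h.
  by move=> ?; lra.
split=> //.
- by case=> [//|k] _; rewrite addn1 mul2n b_odd theta2E subn1.
- have evalXY_div n : evalXY (F n) (x n) (x n.+1) / x n \is a Num.int.
    rewrite evalE xz; have /dvdzP[q ->] := z_dvdF n.
    by rewrite intrM mulfK ?intr_int // -xz.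
  have x_int n : x n \is a Num.int by rewrite xz intr_int.
  case=> [//|m] _; rewrite -(odd_double_half m).
  case: (odd m); rewrite ?add0n ?add1n; last first.
    rewrite a_odd; split; first exact: (intr_int _ 1).
    case: (m./2) => [|k]; last by rewrite b_odd theta2E.
    by rewrite b_1 rpredB // natr_int.
  by rewrite -doubleS a_even b_even natr_int.
split.
- near=> m; rewrite -(odd_double_half m).
  case: (odd m); last by have [-> _ _ _] := cf m./2.
  rewrite gt_eqF // (lt_le_trans _ (den_ge1 _ _)) //.
  by rewrite geq_half_double; near: m; exists (h.*2.*2) => // m /=.
apply: cvgn_even_odd.
  suff -> : (fun k => cf_num a b k.*2 / cf_den a b k.*2) = S by [].
  by apply/funext => k; have [-> _ -> _] := cf k; rewrite mulfK.
(* After a shift by one index this is h times the general term of the convergent series. *)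
have term0 : h%:R ^+ k / x k @[k --> \oo] --> 0.
  rewrite -cvg_shiftS /=; under eq_fun do rewrite exprS -mulrA.
  have := cvgM (cvg_cst (h%:R : R)) (cvg_series_cvg_0 S_cvg).
  by rewrite mulr0; apply.
have err0 : h%:R ^+ k / x k / cf_den a b k.*2.+1 @[k --> \oo] --> 0.
  (* Once Q_(2k+1) >= 1, dividing by it can only decrease h^k/x_k. *)
  apply: (squeeze_cvgr _ (cvg_cst 0) term0).
  near=> k.
  have den_k : 1 <= cf_den a b k.*2.+1.
    by apply: den_ge1; near: k; exists h.*2.
  have den_pos : 0 < cf_den a b k.*2.+1 by exact: lt_le_trans den_k.
  have hx_ge0 : 0 <= h%:R ^+ k / x k by rewrite divr_ge0 ?exprn_ge0 // ltW.
  by rewrite divr_ge0 ?(ltW den_pos) //= ler_pdivrMr // ler_peMr.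
have odd_conv : \forall k \near \oo,
    S k + h%:R ^+ k / x k / cf_den a b k.*2.+1
    = cf_num a b k.*2.+1 / cf_den a b k.*2.+1.
  near=> k; have [_ den_k _ ->] := cf k; rewrite -den_k mulrDl mulfK //.
  rewrite gt_eqF // (lt_le_trans _ (den_ge1 _ _)) //.
  by near: k; exists h.*2.
rewrite -[limn _]addr0; apply: cvg_trans (cvgD S_cvg err0).
exact: near_eq_cvg odd_conv.
Unshelve. all: by end_near.
Qed.
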